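(* Let $u^0=u_0$ and let $(u^n)$ be the solution, under periodic boundary conditions on $\mathcal O$, of the midpoint temporal semi-discretization $$iu^{n+1}=iu^{n}+\Delta t\Big(\Delta u^{n+\frac12}+Q(x)u^{n+\frac12}\Big)+u^{n+\frac12}\Delta \tilde W_{n},\qquad n=0,1,\dots,N,$$ of the stochastic linear Schr\''odinger equation $i\,du-(\Delta u+Q(x)u)\,dt=u\circ dW$, $u(x,0)=u_0(x)$, where $u^{n+\frac12}=\frac12(u^{n+1}+u^n)$. Then the discrete charge conservation law holds: $$\int_{\mathcal O}|u^{n+1}(x)|^{2}\,dx=\int_{\mathcal O}|u^{n}(x)|^{2}\,dx,\qquad n=0,1,\dots,N.$$
   Context: $\mathcal O\subset\mathbb R^d$ is a (rectangular) domain with periodic boundary conditions; $Q\in\mathbb H^3(\mathcal O)$ is a real-valued potential; $\mathbb H^\gamma$ denotes the ($L^2$-based) Sobolev space of order $\gamma$, $\mathbb H^0=\mathbb L^2$. $W(t,x,\omega)=\sum_{k}\beta_k(t,\omega)\,\phi e_k(x)$ is a real-valued Wiener process on a filtered probability space $(\Omega,\mathcal F,P,\{\mathcal F_t\})$: $(e_k)$ is an orthonormal basis of $\mathbb L^2(\mathcal O)$, $(\beta_k)$ are independent real Brownian motions, and $\phi$ is a Hilbert--Schmidt operator from $\mathbb L^2$ to $\mathbb H^\gamma$. $\circ$ denotes the Stratonovich product. $\Delta$ without a following time symbol is the Laplacian; $\Delta t=T/N$ is the time step, $t_n=n\Delta t$. The truncated increment is $\Delta\tilde W_n=\sum_k\sqrt{\Delta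 t}\,\zeta^{\kappa}_{k,n}\,\phi e_k(x)$, where $\xi_{k,n}=(\beta_k(t_{n+1})-\beta_k(t_n))/\sqrt{\Delta t}$ are standard Gaussian variables, $\kappa=\sqrt{4|\ln(\Delta t)|}$, and $\zeta^\kappa_{k,n}=\kappa$ if $\xi_{k,n}>\kappa$, $\zeta^\kappa_{k,n}=\xi_{k,n}$ if $|\xi_{k,n}|\le\kappa$, $\zeta^\kappa_{k,n}=-\kappa$ if $\xi_{k,n}<-\kappa$. In particular $\Delta\tilde W_n$ is real-valued. The identity is understood almost surely. *)

(* Defs.v *)
From HB Require Import structures.
From mathcomp Require Import all_boot all_order all_algebra.
From mathcomp Require Import finmap.
From mathcomp Require Import all_classical all_reals all_analysis.
From mathcomp Require Import complex.

Set Implicit Arguments.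
Unset Strict Implicit.
Unset Printing Implicit Defensive.

Import Order.TTheory GRing.Theory Num.Theory.
Import numFieldNormedType.Exports.

Local Open Scope classical_set_scope.
Local Open Scope ring_scope.

(* Points of R^d are d-tuples, for which the library has the product
   (hence Borel) sigma-algebra; the library has no d-dimensional Lebesgue
   measure, so it is built here by iterating binary products. *)
Notation Rpoint R d := (d.-tuple (measurableTypeR R)).

Section lebesgue_measure_dim.
Context {R : realType}.

Definition point_cons n (p : measurableTypeR R * Rpoint R n) : Rpoint R n.+1 :=
  [tuple of p.1 :: p.2].

Definition point_uncons n (x : Rpoint R n.+1) : measurableTypeR R * Rpoint R n :=
  (thead x, [tuple of behead x]).

Lemma point_consK n : cancel (@point_cons n) (@point_uncons n).
Proof. by case=> t x; congr pair; apply/val_inj. Qed.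

Lemma measurable_point_cons n : measurable_fun [set: _] (@point_cons n).
Proof. exact: measurable_cons. Qed.

Lemma measurable_point_uncons n : measurable_fun [set: _] (@point_uncons n).
Proof.
apply: measurable_fun_pair; first exact: (@measurable_tnth _ _ _ ord0).
exact: measurable_behead.
Qed.

Section step.
Context (n : nat) (mu : {sigma_finite_measure set (Rpoint R n) -> \bar R}).

Let leb1 : {sigma_finite_measure set (measurableTypeR R) -> \bar R} :=
  @lebesgue_measure R.

Let prod : {measure set (measurableTypeR R * Rpoint R n)%type -> \bar R} :=
  (leb1 \x mu)%E.

Definition lebesgue_step : set (Rpoint R n.+1) -> \bar R :=
  pushforward prod (@point_cons n).

HB.instance Definition _ := Measure.copy lebesgue_step
  (measure_function_pushforward__canonical__measure_function_Measure
     prod (@measurable_point_cons n)).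

Lemma lebesgue_step_sigma_finite : sigma_finite setT lebesgue_step.
Proof.
have /sigma_finiteP[F [TF ndF Foo]] := sigma_finiteT leb1.
have /sigma_finiteP[G [TG ndG Goo]] := sigma_finiteT mu.
exists (fun k => @point_uncons n @^-1` (F k `*` G k)).
  rewrite -preimage_bigcup (_ : \bigcup_k _ = setT) ?preimage_setT//.
  rewrite -subTset => -[x y] _.
  have [k _ Fkx] : (\bigcup_k F k) x by rewrite -TF.
  have [l _ Gly] : (\bigcup_k G k) y by rewrite -TG.
  exists (maxn k l) => //; split => /=.
  - by move: x Fkx; exact/subsetPset/ndF/leq_maxl.
  - by move: y Gly; exact/subsetPset/ndG/leq_maxr.
move=> k; have [mF Fk] := Foo k; have [mG Gk] := Goo k; split.
  rewrite -[X in measurable X]setTI; apply: measurable_point_uncons => //.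
  exact: measurableX.
rewrite /lebesgue_step /pushforward -comp_preimage.
rewrite (_ : _ \o _ = id); last by rewrite funeqE => x; exact: point_consK.
by rewrite preimage_id /prod /= product_measure1E// lte_mul_pinfty// ge0_fin_numE.
Qed.

HB.instance Definition _ := Measure_isSigmaFinite.Build _ _ _ lebesgue_step
  lebesgue_step_sigma_finite.

End step.

Fixpoint lebesgue_dim (n : nat) : {sigma_finite_measure set (Rpoint R n) -> \bar R} :=
  match n with
  | 0 => dirac ([tuple] : Rpoint R 0)
  | n.+1 => lebesgue_step (lebesgue_dim n)
  end.

Lemma lebesgue_dim_prod n (A : 'I_n -> set (measurableTypeR R)) :
  (forall i, measurable (A i)) ->
  lebesgue_dim n [set x | forall i, A i (tnth x i)] =
  (\prod_i @lebesgue_measure R (A i))%E.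
Proof.
elim: n A => [|n IH] A mA /=.
  by rewrite big_ord0 /= diracE mem_set//= => -[].
have tl (t : R) (x : Rpoint R n) j : tnth (point_cons (t, x)) (lift ord0 j) = tnth x j.
  by rewrite !(tnth_nth t).
rewrite big_ord_recl -IH// -product_measure1E//.
  rewrite /lebesgue_step /pushforward; congr (_ _).
  apply/seteqP; split => -[t x] /=.
    move=> h; split; first by have := h ord0.
    by move=> i; have := h (lift ord0 i); rewrite tl.
  move=> [h1 h2] i; have [j ->|->//] := unliftP ord0 i.
  by rewrite tl; exact: h2.
rewrite (_ : [set x | _] =
    \bigcap_(i in [set: 'I_n]) (fun x => tnth x i) @^-1` A (lift ord0 i)).
  apply: fin_bigcap_measurable => // i _.
  by rewrite -[X in measurable X]setTI; exact: measurable_tnth.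
by apply/seteqP; split => x /= h i; [move=> _|]; exact: h.
Qed.

End lebesgue_measure_dim.

(* A function on the torus R^d / prod_i (b i - a i) Z is represented by any
   function on R^d, of which only the values in the box matter, everything
   being taken almost everywhere for [box_measure a b]. *)
Section box.
Context {R : realType} {d : nat} (a b : 'I_d -> R).

Definition box : set (Rpoint R d) := [set x | forall i, a i < tnth x i < b i].

Lemma measurable_box : measurable box.
Proof.
rewrite (_ : box =
    \bigcap_(i in [set: 'I_d]) (fun x => tnth x i) @^-1` `]a i, b i[%classic).
  apply: fin_bigcap_measurable => // i _.
  by rewrite -[X in measurable X]setTI; exact: measurable_tnth.
apply/seteqP; split => x /= xab i; first by move=> _; rewrite /= in_itv/=.
by have := xab i I; rewrite /= in_itv.
Qed.

Definition box_measure : {measure set (Rpoint R d) -> \bar R} :=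
  mrestr (lebesgue_dim d) measurable_box.

Local Notation mu := box_measure.
Implicit Types u v : Rpoint R d -> R[i].

Definition toC (f : Rpoint R d -> R) : Rpoint R d -> R[i] := fun x => (f x)%:C%C.

Definition Lfun2C u :=
  ((fun x => complex.Re (u x)) \in Lfun mu 2%:E) /\
  ((fun x => complex.Im (u x)) \in Lfun mu 2%:E).

Definition integralC u : R[i] :=
  Complex (\int[mu]_x complex.Re (u x)) (\int[mu]_x complex.Im (u x)).

Definition abs2 (z : R[i]) : R := complex.ComplexField.Normc.normc z ^+ 2.

Definition total_charge u : \bar R := (\int[mu]_x (abs2 (u x))%:E)%E.

Definition volume : R := \prod_i (b i - a i).

Definition wavenumber (k : {ffun 'I_d -> int}) (i : 'I_d) : R :=
  2 * pi * (k i)%:~R / (b i - a i).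

Definition wavenumber2 k : R := \sum_i wavenumber k i ^+ 2.

Definition phase k (x : Rpoint R d) : R := \sum_i wavenumber k i * tnth x i.

(* Coefficients in the orthonormal basis volume^(-1/2) exp (i xi_k . x), so
   that [sobolev_norm2 0] is the square of the L^2 norm. *)
Definition fourier_coef u k : R[i] :=
  (Num.sqrt volume)^-1%:C%C *
  integralC (fun x => u x * Complex (cos (phase k x)) (- sin (phase k x))).

(* Fourier definition of the periodic H^s, for a real order s >= 0. *)
Definition sobolev_norm2 (s : R) u : \bar R :=
  (\esum_(k in [set: {ffun 'I_d -> int}])
     ((1 + wavenumber2 k) `^ s * abs2 (fourier_coef u k))%:E)%E.

Definition sobolev (s : R) u := Lfun2C u /\ (sobolev_norm2 s u < +oo)%E.

Definition row_of (x : Rpoint R d) : 'rV[R]_d := \row_i tnth x i.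

Definition partial (i : 'I_d) (f : 'rV[R]_d -> R) : 'rV[R]_d -> R :=
  'D_(delta_mx 0 i) f.

(* All iterated partial derivatives exist and are continuous. *)
Definition smooth (f : 'rV[R]_d -> R) := forall s : seq 'I_d,
  let g := foldr partial f s in
  continuous g /\ forall i x, derivable g x (delta_mx 0 i).

Definition box_periodic (f : 'rV[R]_d -> R) :=
  forall x i, f (x + (b i - a i) *: delta_mx 0 i) = f x.

Definition laplacian (f : 'rV[R]_d -> R) : 'rV[R]_d -> R :=
  fun x => \sum_i partial i (partial i f) x.

(* Testing against real functions suffices, by linearity. *)
Definition weak_laplacian u v := forall f, smooth f -> box_periodic f ->
  integralC (fun x => v x * (f (row_of x))%:C%C) =
  integralC (fun x => u x * (laplacian f (row_of x))%:C%C).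

Definition L2norm (f : Rpoint R d -> R) : \bar R := 'N[mu]_2%:E[EFin \o f].

Definition L2dot (f g : Rpoint R d -> R) : R := \int[mu]_x (f x * g x).

(* s is the sum of the series of the f k, in L^2. *)
Definition L2sum (f : nat -> Rpoint R d -> R) (s : Rpoint R d -> R) :=
  [/\ forall k, f k \in Lfun mu 2%:E, s \in Lfun mu 2%:E &
   (fun n => L2norm (fun x => \sum_(k < n) f k x - s x)) @ \oo --> 0%E].

Definition orthonormal_basis (e : nat -> Rpoint R d -> R) :=
  [/\ forall k, e k \in Lfun mu 2%:E,
      forall j k, L2dot (e j) (e k) = (j == k)%:R &
      forall f, f \in Lfun mu 2%:E ->
        L2sum (fun k x => L2dot f (e k) * e k x) f].

(* phi acts on representatives, hence the linearity almost everywhere. *)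
Definition hilbert_schmidt (s : R) (e : nat -> Rpoint R d -> R)
    (phi : (Rpoint R d -> R) -> (Rpoint R d -> R)) :=
  [/\ forall f, f \in Lfun mu 2%:E -> sobolev s (toC (phi f)),
      forall (c : R) f g, f \in Lfun mu 2%:E -> g \in Lfun mu 2%:E ->
        {ae mu, forall x, phi (fun y => c * f y + g y) x = c * phi f x + phi g x},
      exists C : R, forall f, f \in Lfun mu 2%:E ->
        (sobolev_norm2 s (toC (phi f)) <= C%:E * L2norm f ^+ 2)%E &
      (\sum_(0 <= k <oo) sobolev_norm2 s (toC (phi (e k))) < +oo)%E].

End box.

Section noise.
Context {R : realType} {disp : measure_display} {Omega : measurableType disp}.
Variable P : probability Omega R.

Definition filtration (F : R -> set (set Omega)) :=
  [/\ forall t, 0 <= t -> sigma_algebra setT (F t),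
      forall t, 0 <= t -> F t `<=` measurable &
      forall s t, 0 <= s <= t -> F s `<=` F t].

Definition sigma_of (X : Omega -> R) : set (set Omega) :=
  preimage_set_system setT X (measurable : set (set (measurableTypeR R))).

Definition sigma_of_process (X : R -> Omega -> R) : set (set Omega) :=
  <<s \bigcup_(t in [set t | 0 <= t]) sigma_of (X t) >>.

Definition independent2 (G H : set (set Omega)) :=
  forall A B, G A -> H B -> P (A `&` B) = (P A * P B)%E.

Definition independent (G : nat -> set (set Omega)) :=
  forall (J : {fset nat}) (A : nat -> set Omega),
    (forall j, j \in J -> G j (A j)) ->
    P (\bigcap_(j in [set` J]) A j) = (\prod_(j <- J) P (A j))%E.

(* The second parameter of [normal_prob] is the standard deviation. *)
Definition brownian_motion (F : R -> set (set Omega))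
    (B : R -> {RV P >-> measurableTypeR R}) :=
  [/\ {ae P, forall w, B 0 w = 0},
      forall t, 0 <= t -> sigma_of (B t) `<=` F t,
      forall s t, 0 <= s < t ->
        independent2 (F s) (sigma_of (fun w => B t w - B s w)),
      forall s t, 0 <= s < t -> forall A : set (measurableTypeR R), measurable A ->
        P [set w | A (B t w - B s w)] = normal_prob 0 (Num.sqrt (t - s)) A &
      {ae P, forall w, {within `[0, +oo[, continuous (fun t => B t w : R)}}].

Definition wiener_process {d : nat} (a b : 'I_d -> R) (F : R -> set (set Omega))
    (s : R) (e : nat -> Rpoint R d -> R)
    (phi : (Rpoint R d -> R) -> (Rpoint R d -> R))
    (beta : nat -> R -> {RV P >-> measurableTypeR R})
    (W : R -> Omega -> Rpoint R d -> R) :=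
  [/\ orthonormal_basis a b e,
      hilbert_schmidt a b s e phi,
      forall k, brownian_motion F (beta k),
      independent (fun k => sigma_of_process (fun t w => beta k t w)) &
      forall t, 0 <= t -> {ae P, forall w,
        L2sum a b (fun k x => beta k t w * phi (e k) x) (W t w)}].

Definition truncate (kappa x : R) : R :=
  if x > kappa then kappa else if x < - kappa then - kappa else x.

Definition truncated_normal (dt : R)
    (beta : nat -> R -> {RV P >-> measurableTypeR R}) (k n : nat) (w : Omega) : R :=
  truncate (Num.sqrt (4 * `|ln dt|))
    ((beta k (n.+1%:R * dt) w - beta k (n%:R * dt) w) / Num.sqrt dt).

Definition truncated_increment {d : nat} (a b : 'I_d -> R) (dt : R)
    (e : nat -> Rpoint R d -> R) (phi : (Rpoint R d -> R) -> (Rpoint R d -> R))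
    (beta : nat -> R -> {RV P >-> measurableTypeR R}) (n : nat)
    (dW : Omega -> Rpoint R d -> R) :=
  {ae P, forall w, L2sum a b
    (fun k x => Num.sqrt dt * truncated_normal dt beta k n w * phi (e k) x) (dW w)}.

End noise.

Section scheme.
Context {R : realType} {d : nat} (a b : 'I_d -> R).
Local Notation mu := (box_measure a b).

Definition midpoint (u v : Rpoint R d -> R[i]) : Rpoint R d -> R[i] :=
  fun x => 2^-1 * (v x + u x).

(* The equation i v = i u + dt (Delta m + Q m) + m dW holds in L^2 with
   m = (u + v) / 2 in the periodic H^2; u and v need only be in L^2. *)
Definition midpoint_step (dt : R) (Q dW : Rpoint R d -> R)
    (u v : Rpoint R d -> R[i]) :=
  let m := midpoint u v in
  sobolev a b 2 m /\
  exists lap, [/\ Lfun2C a b lap, weak_laplacian a b m lap &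
    {ae mu, forall x,
      'i%C * v x = 'i%C * u x + dt%:C%C * (lap x + (Q x)%:C%C * m x)
                   + m x * (dW x)%:C%C}].

Definition midpoint_solution {disp : measure_display}
    {Omega : measurableType disp} (P : probability Omega R) (dt : R) (N : nat)
    (Q : Rpoint R d -> R) (dW : nat -> Omega -> Rpoint R d -> R)
    (u0 : Omega -> Rpoint R d -> R[i]) (u : nat -> Omega -> Rpoint R d -> R[i]) :=
  {ae P, forall w,
    [/\ {ae mu, forall x, u 0 w x = u0 w x},
        forall n, (n <= N.+1)%N -> Lfun2C a b (u n w) &
        forall n, (n <= N)%N -> midpoint_step dt Q (dW n w) (u n w) (u n.+1 w)]}.

End scheme.

(* Main.v *)
Require Import Defs.
From mathcomp Require Import all_boot all_order all_algebra.
From mathcomp Require Import finmap.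
From mathcomp Require Import all_classical all_reals all_analysis.
From mathcomp Require Import complex.
From mathcomp Require Import measurable_realfun ring lra.

Set Implicit Arguments.
Unset Strict Implicit.
Unset Printing Implicit Defensive.

Import Order.TTheory GRing.Theory Num.Theory.
Import numFieldNormedType.Exports.

Local Open Scope classical_set_scope.
Local Open Scope ring_scope.

(** The charge is conserved path by path: once the sample point is fixed, one
step of the scheme is a deterministic identity in which Q and the increment
only enter as real-valued multipliers. Write u and v for two successive
iterates, m = (u + v) / 2 and l for the Laplacian of m. Multiplying the scheme
by the conjugate of m and taking imaginary parts, the left-hand side gives
(|v|^2 - |u|^2) / 2, while Q |m|^2 and |m|^2 dW are real and disappear. Hence,
almost everywhere, |v|^2 - |u|^2 = 2 dt Im (l conj(m))
([midpoint_charge_density]), and the theorem says that the integral of the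
right-hand side over the box is zero, that is, that the Laplacian is symmetric
([weak_laplacian_symmetric]).

The Laplacian of m being a weak one, tested against smooth periodic functions,
this symmetry is not a formal integration by parts: m has to be approximated by
test functions whose Laplacians approximate l. The approximation is spectral.
The Hartley functions h_k = (2 / vol)^(1/2) cos (xi_k . x - pi / 4), with k in
Z^d, are smooth, periodic, orthonormal ([hartley_orthonormal]) and
eigenfunctions of the Laplacian. Tested against them, the weak equation says
that the coefficients of l are those of m multiplied by - |xi_k|^2
([weak_laplacian_coef]). These multipliers are real, so that the inner products
of Im l with Re m and of Re l with Im m have the same expansion
([dot_adjoint], which rests on the Parseval identity).

The Parseval identity requires the completeness of the family
([hartley_dense]). The trigonometric polynomials form an algebra. For every
coordinate i and every real be, one of them has, on the box, the sign of
x_i - be ([trig_sign]); composing it with polynomials that converge boundedly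
to a step function, and taking products, one gets the indicators of the orthants
as bounded limits, on the box, of trigonometric polynomials. The orthants are stable under
intersection and generate the sigma-algebra, and a functional form of the
pi-lambda theorem ([L2_closure_full]) reaches all square integrable
functions. *)

(** * The inner product of square integrable functions *)

Section dot.
Context {d : measure_display} {T : measurableType d} {R : realType}.
Variable mu : {measure set T -> \bar R}.
Implicit Types f g h : T -> R.

Definition dot f g : R := \int[mu]_x (f x * g x).

Local Notation L2 := (Lfun mu 2%:E).

Lemma L2_measurable f : f \in L2 -> measurable_fun setT f.
Proof. by rewrite inE => /andP[]; rewrite inE. Qed.

Lemma L2P f : f \in L2 <->
  measurable_fun setT f /\ mu.-integrable setT (fun x => (f x ^+ 2)%:E).
Proof.
split=> [f2|[mf /integrableP[_ i2]]].
  by split; [exact: L2_measurable|exact: Lfun2_integrable_sqr].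
rewrite inE; apply/andP; rewrite !inE/=; split=> //.
rewrite /finite_norm unlock poweR_lty//; apply: le_lt_trans i2.
apply: ge0_le_integral => //.
- by move=> x _; rewrite poweR_ge0.
- apply/measurable_EFinP.
  apply: (@measurableT_comp _ _ _ _ _ _ (fun x : R => x `^ 2)%R) => //.
  exact: measurableT_comp.
- by do 2 apply: measurableT_comp => //; exact: measurable_funX.
- by move=> x _; rewrite /= powR_mulrn// lee_fin normrX.
Qed.

Lemma integrable_mul f g : f \in L2 -> g \in L2 ->
  mu.-integrable setT (EFin \o (fun x => f x * g x)).
Proof.
by move=> f2 g2; exact/(Lfun1_integrable mu (f \* g)).1/Lfun2_mul_Lfun1.
Qed.

Lemma L2D f g : f \in L2 -> g \in L2 -> (fun x => f x + g x) \in L2.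
Proof.
move=> f2 g2; have -> : (fun x => f x + g x) = f + g by apply/funext.
have [_ clD] := Lfun_addr_closed mu (lee1n 2).
exact: clD.
Qed.

Lemma L2Z c f : f \in L2 -> (fun x => c * f x) \in L2.
Proof.
move=> f2; have -> : (fun x => c * f x) = (fun x => f x * c).
  by apply/funext => x; rewrite mulrC.
by apply: (Lfun_scale c _ f2); rewrite (ler_nat _ 1 2).
Qed.

Lemma L2B f g : f \in L2 -> g \in L2 -> (fun x => f x - g x) \in L2.
Proof.
move=> f2 g2; have -> : (fun x => f x - g x) = (fun x => f x + (-1) * g x).
  by apply/funext => x; rewrite mulN1r.
by apply: L2D => //; exact: L2Z.
Qed.

Lemma L2_sum I (s : seq I) (c : I -> R) (h : I -> T -> R) :
  (forall i, h i \in L2) -> (fun x => \sum_(i <- s) c i * h i x) \in L2.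
Proof.
move=> h2; elim: s => [|i s IH].
  have -> : (fun x => \sum_(i <- [::]) c i * h i x) = (fun=> 0).
    by apply/funext => x; rewrite big_nil.
  by apply/L2P; split=> //; under eq_fun do rewrite expr0n; exact: integrable0.
have -> : (fun x => \sum_(j <- i :: s) c j * h j x) =
    (fun x => c i * h i x + \sum_(j <- s) c j * h j x).
  by apply/funext => x; rewrite big_cons.
by apply: L2D => //; exact: L2Z.
Qed.

Lemma dotC f g : dot f g = dot g f.
Proof. by apply: eq_Rintegral => x _; rewrite mulrC. Qed.

Lemma dotDl f g h : f \in L2 -> g \in L2 -> h \in L2 ->
  dot (fun x => f x + g x) h = dot f h + dot g h.
Proof.
move=> f2 g2 h2; rewrite /dot -RintegralD//; try exact: integrable_mul.
by apply: eq_Rintegral => x _; rewrite mulrDl.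
Qed.

Lemma dotZl c f h : f \in L2 -> h \in L2 ->
  dot (fun x => c * f x) h = c * dot f h.
Proof.
move=> f2 h2; rewrite /dot -RintegralZl//; last exact: integrable_mul.
by apply: eq_Rintegral => x _; rewrite mulrA.
Qed.

Lemma dotBl f g h : f \in L2 -> g \in L2 -> h \in L2 ->
  dot (fun x => f x - g x) h = dot f h - dot g h.
Proof.
move=> f2 g2 h2; rewrite /dot -RintegralB//; try exact: integrable_mul.
by apply: eq_Rintegral => x _; rewrite mulrBl.
Qed.

Lemma dotBr f g h : f \in L2 -> g \in L2 -> h \in L2 ->
  dot h (fun x => f x - g x) = dot h f - dot h g.
Proof. by move=> *; rewrite !(dotC h) dotBl. Qed.

Lemma dot_suml I (s : seq I) (c : I -> R) (h : I -> T -> R) f :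
  (forall i, h i \in L2) -> f \in L2 ->
  dot (fun x => \sum_(i <- s) c i * h i x) f = \sum_(i <- s) c i * dot (h i) f.
Proof.
move=> h2 f2; elim: s => [|i s IH].
  rewrite big_nil -[RHS](mul0r (fine (mu setT))) -Rintegral_cst//.
  by apply: eq_Rintegral => x _; rewrite big_nil mul0r.
rewrite big_cons -IH -dotZl// -dotDl//; [|exact: L2Z|exact: L2_sum].
by apply: eq_Rintegral => x _; rewrite big_cons.
Qed.

Lemma dot_ge0 f : 0 <= dot f f.
Proof. by apply: Rintegral_ge0 => x _; rewrite -expr2 sqr_ge0. Qed.

(** A substitute for the triangle inequality that stays with squared norms; it
follows from the parallelogram identity. *)
Lemma dotD_le f g : f \in L2 -> g \in L2 ->
  dot (fun x => f x + g x) (fun x => f x + g x) <= 2 * (dot f f + dot g g).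
Proof.
move=> f2 g2.
have fg2 := L2D f2 g2; have fmg2 := L2B f2 g2.
suff : dot (fun x => f x + g x) (fun x => f x + g x) +
   dot (fun x => f x - g x) (fun x => f x - g x) = 2 * (dot f f + dot g g).
  by move=> <-; rewrite lerDl dot_ge0.
rewrite dotDl// dotBl// (dotC f) (dotC g) !dotDl//.
rewrite (dotC f (fun x => _ - _)) (dotC g (fun x => _ - _)) !dotBl// (dotC g f).
ring.
Qed.

End dot.

(** * Density of a subspace of L2 from a generating pi-system *)

Section density.
Import HBSimple HBNNSimple.
Context {d : measure_display} {T : measurableType d} {R : realType}.
Variable mu : {measure set T -> \bar R}.
Local Notation L2 := (Lfun mu 2%:E).
Local Notation "''[' f , g ]" := (dot mu f g).
Implicit Types (f g : T -> R).

Variable V : set (T -> R).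
Hypothesis V2 : forall t, V t -> t \in L2.
Hypothesis VD : forall s t, V s -> V t -> V (fun x => s x + t x).
Hypothesis VZ : forall c t, V t -> V (fun x => c * t x).

Definition L2_closure f := f \in L2 /\
  forall e : R, 0 < e -> exists2 t, V t &
    '[fun x => f x - t x, fun x => f x - t x] < e.

Lemma sub_L2_closure t : V t -> L2_closure t.
Proof.
move=> Vt; split; first exact: V2.
move=> e e0; exists t => //; apply: le_lt_trans e0.
rewrite -[leRHS](mul0r (fine (mu setT))) -Rintegral_cst// le_eqVlt; apply/orP; left.
by apply/eqP; apply: eq_Rintegral => x _; rewrite subrr mulr0.
Qed.

Lemma L2_closure_trans f : f \in L2 ->
  (forall e : R, 0 < e -> exists2 g, L2_closure g &
    '[fun x => f x - g x, fun x => f x - g x] < e) ->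
  L2_closure f.
Proof.
move=> f2 fclose; split=> // e e0.
have e40 : 0 < e / 4 by rewrite divr_gt0.
have [g [g2 gclose] fg] := fclose _ e40; have [t Vt gt] := gclose _ e40.
exists t => //.
have fg2 := L2B f2 g2; have gt2 := L2B g2 (V2 Vt).
have -> : (fun x => f x - t x) = (fun x => (f x - g x) + (g x - t x)).
  by apply/funext => x; ring.
by apply: le_lt_trans (dotD_le fg2 gt2) _; lra.
Qed.

Lemma L2_closureD f g : L2_closure f -> L2_closure g ->
  L2_closure (fun x => f x + g x).
Proof.
move=> [f2 fc] [g2 gc]; split; first exact: L2D.
move=> e e0; have e40 : 0 < e / 4 by rewrite divr_gt0.
have [s Vs fs] := fc _ e40; have [t Vt gt] := gc _ e40.
exists (fun x => s x + t x); first exact: VD.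
have fs2 := L2B f2 (V2 Vs); have gt2 := L2B g2 (V2 Vt).
have -> : (fun x => f x + g x - (s x + t x)) =
    (fun x => (f x - s x) + (g x - t x)) by apply/funext => x; ring.
by apply: le_lt_trans (dotD_le fs2 gt2) _; lra.
Qed.

Lemma L2_closureZ c f : L2_closure f -> L2_closure (fun x => c * f x).
Proof.
move=> [f2 fc]; split; first exact: L2Z.
move=> e e0.
(* Adding 1 to c^2 covers the case c = 0. *)
have c0 : 0 < c ^+ 2 + 1 by rewrite ltr_wpDl// sqr_ge0.
have [t Vt ft] := fc _ (divr_gt0 e0 c0); exists (fun x => c * t x).
  exact: VZ.
have ft2 := L2B f2 (V2 Vt).
have -> : (fun x => c * f x - c * t x) = (fun x => c * (f x - t x)).
  by apply/funext => x; ring.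
rewrite dotZl//; last exact: L2Z.
rewrite dotC dotZl// mulrA -expr2.
move: ft; rewrite ltr_pdivlMr//; apply: le_lt_trans.
by rewrite mulrC ler_wpM2l ?dot_ge0// lerDl.
Qed.

Lemma L2_closureB f g : L2_closure f -> L2_closure g ->
  L2_closure (fun x => f x - g x).
Proof.
move=> fc gc; have -> : (fun x => f x - g x) = (fun x => f x + (-1) * g x).
  by apply/funext => x; rewrite mulN1r.
by apply: L2_closureD => //; exact: L2_closureZ.
Qed.

(** Dominated convergence: the integrals of (f - f_n)^2, which are bounded by
(|f| + g)^2, tend to zero. *)
Lemma L2_closure_lim (f_ : (T -> R)^nat) f g :
  (forall n, L2_closure (f_ n)) -> f \in L2 -> g \in L2 ->
  (forall n x, `|f_ n x| <= g x) ->
  {ae mu, forall x, f_ ^~ x @ \oo --> f x} ->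
  L2_closure f.
Proof.
move=> fc f2 g2 fg f_f; apply: L2_closure_trans => // e e0.
have f_2 n : f_ n \in L2 by case: (fc n).
pose G x := (`|f x| + g x) ^+ 2.
have G2 : mu.-integrable setT (EFin \o G).
  have g0 x : 0 <= g x by rewrite (le_trans _ (fg 0%N x)).
  have nf2 : (fun x => `|f x|) \in L2.
    have [mf i2] := (L2P _ _).1 f2; apply/L2P; split; first exact: measurableT_comp.
    by under eq_fun do rewrite real_normK ?num_real//.
  exact: ((L2P _ _).1 (L2D nf2 g2)).2.
have [|||||_ _] := @dominated_convergence _ _ _ mu setT measurableT
    (fun n x => ((f x - f_ n x) ^+ 2)%:E) (fun=> 0%E) (EFin \o G).
- by move=> n; exact: (measurable_int mu ((L2P _ _).1 (L2B f2 (f_2 n))).2).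
- exact: measurable_cst.
- apply: filterS f_f => x xf _ /=.
  apply: cvg_EFin; first exact: nearW.
  rewrite /comp/=.
  have -> : (0 : R) = (f x - f x) ^+ 2 by rewrite subrr expr0n.
  by apply: (@cvg_comp _ _ _ _ (fun y : R => y ^+ 2) _ (nbhs (f x - f x)));
    [apply: cvgB => //; exact: cvg_cst|exact: exprn_continuous].
- exact: G2.
- apply: aeW => x n _ /=; rewrite lee_fin ger0_norm ?sqr_ge0//.
  rewrite /G -[leLHS]real_normK ?num_real// lerXn2r ?nnegrE ?addr_ge0//.
    by rewrite (le_trans _ (fg n x)).
  by rewrite (le_trans (ler_normB _ _))// lerD2l.
rewrite integral0 => /fine_cvgP[_ /cvgrPdist_lt/(_ _ e0)[N _ /(_ N (leqnn N))]].
rewrite /= sub0r normrN => Ne; exists (f_ N) => //.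
apply: le_lt_trans Ne; rewrite ler_normr /dot /Rintegral; apply/orP; left.
by under eq_integral do rewrite -expr2.
Qed.

Hypothesis mu_fin : (mu setT < +oo)%E.

Lemma L2_bounded f (M : R) : measurable_fun setT f -> (forall x, `|f x| <= M) ->
  f \in L2.
Proof.
move=> mf fM; apply/L2P; split=> //.
apply: measurable_bounded_integrable => //; first exact: measurable_funX.
exists (M ^+ 2); split; first exact: num_real.
move=> B MB x _ /=; rewrite normrX (le_trans _ (ltW MB))// lerXn2r// nnegrE.
by rewrite (le_trans _ (fM x)).
Qed.

Lemma L2_indic (A : set T) : measurable A -> (\1_A : T -> R) \in L2.
Proof.
move=> mA; apply: (@L2_bounded _ 1); first exact: measurable_indic.
by move=> x; rewrite indicE; case: (_ \in _); rewrite ?normr0 ?normr1.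
Qed.

Hypothesis V1 : V (fun=> 1).
Variable G : set (set T).
Hypothesis GI : setI_closed G.
Hypothesis mG : (measurable : set (set T)) = <<s G >>.
Hypothesis GV : forall A, G A -> L2_closure (\1_A).

(** The measurable sets whose indicator is in the closure form a lambda-system. *)
Lemma L2_closure_indic (A : set T) : measurable A -> L2_closure (\1_A).
Proof.
pose H := [set B : set T | measurable B /\ L2_closure (\1_B)].
rewrite mG => GA; suff : H A by case.
apply: (@lambda_system_subset T G GI setT H) GA => //.
- split => //.
  + split=> //; have -> : \1_[set: T] = (fun=> 1 : R).
      by apply/funext => x; rewrite indicE in_setT.
    exact: sub_L2_closure.
  + move=> B C CB [mB Bc] [mC Cc]; split; first exact: measurableD.
    have -> : \1_(B `\` C) = (fun x => \1_B x - \1_C x : R).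
      apply/funext => x; rewrite !indicE in_setD.
      have [xC|xC] := boolP (x \in C); last by rewrite andbT subr0.
      have : x \in B by rewrite inE; apply: CB; rewrite inE in xC.
      by move=> ->; rewrite subrr.
    exact: L2_closureB.
  + move=> F ndF FH.
    have mF : measurable (\bigcup_i F i).
      by apply: bigcup_measurable => i _; case: (FH i).
    split=> //.
    apply: (@L2_closure_lim (fun n => \1_(F n)) _ (fun=> 1)).
    * by move=> n; case: (FH n).
    * exact: L2_indic.
    * exact: V2.
    * by move=> n x; rewrite indicE; case: (_ \in _); rewrite ?normr0 ?normr1.
    * apply: aeW => x.
      apply: cvg_near_cst; have [[N _ FNx]|nFx] := pselect ((\bigcup_i F i) x).
        exists N => // n /= Nn; rewrite !indicE !mem_set//; first by exists N.
        by move: x FNx; exact/subsetPset/ndF.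
      apply: nearW => n.
      by rewrite !indicE !memNset// => Fnx; apply: nFx; exists n.
- move=> B GB; split; last exact: GV.
  by rewrite mG; exact: sub_sigma_algebra.
Qed.

(** A functional form of the pi-lambda theorem: from indicators to nonnegative
functions through simple functions that increase to them, then to differences
of nonnegative functions. *)
Lemma L2_closure_full f : f \in L2 -> L2_closure f.
Proof.
have nonneg g : g \in L2 -> (forall x, 0 <= g x) -> L2_closure g.
  move=> g2 g0; have mg := L2_measurable g2.
  have mg' : measurable_fun setT (EFin \o g) by exact/measurable_EFinP.
  pose g_ n := nnsfun_approx measurableT mg' n.
  apply: (@L2_closure_lim (fun n => g_ n) g g) => //.
  - move=> n; have -> : (g_ n : T -> R) = (fun x =>
        \sum_(y <- fset_set (range (g_ n))) y * \1_(g_ n @^-1` [set y]) x).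
      apply/funext => x; rewrite [LHS]fimfunE fsbig_finite//=.
    elim: (fset_set _ : seq R) => [|y s IH].
      have -> : (fun x => \sum_(y <- [::]) y * \1_(g_ n @^-1` [set y]) x) =
          (fun=> 0 * 1 : R) by apply/funext => x; rewrite big_nil mul0r.
      exact/L2_closureZ/sub_L2_closure.
    under eq_fun do rewrite big_cons.
    by apply: L2_closureD => //; exact/L2_closureZ/L2_closure_indic.
  - move=> n x; rewrite ger0_norm// -lee_fin /g_ nnsfun_approxE.
    by apply: le_approx => // y _; rewrite lee_fin.
  - apply: aeW => x.
    have /fine_cvgP[_] := cvg_nnsfun_approx measurableT mg'
      (fun y _ => g0 y : (0 <= (EFin \o g) y)%E) (I : setT x).
    exact.
move=> f2; have -> : f = (fun x => Num.max (f x) 0 - Num.max (- f x) 0).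
  apply/funext => x; rewrite /Num.max.
  by case: ltrP => ?; case: ltrP => ?; lra.
have max2 h : h \in L2 -> (fun x => Num.max (h x) 0) \in L2.
  move=> /L2P[mh i2]; apply/L2P; split; first exact: measurable_maxr.
  apply: le_integrable i2 => //.
    by apply/measurable_EFinP/measurable_funX; exact: measurable_maxr.
  move=> x _ /=; rewrite lee_fin !normrX lerXn2r ?nnegrE//.
  by rewrite /Num.max; case: ifP; rewrite ?normr0.
apply: L2_closureB; apply: nonneg => //.
- exact: max2.
- by move=> x; rewrite le_max lexx orbT.
- apply: max2; have -> : (fun x => - f x) = (fun x => (-1) * f x).
    by apply/funext => x; rewrite mulN1r.
  exact: L2Z.
- by move=> x; rewrite le_max lexx orbT.
Qed.

End density.

(** * Orthonormal families with a dense span *)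

Section orthonormal.
Context {d : measure_display} {T : measurableType d} {R : realType}.
Variable mu : {measure set T -> \bar R}.
Variables (I : eqType) (h : I -> T -> R).
Local Notation L2 := (Lfun mu 2%:E).
Local Notation "''[' f , g ]" := (dot mu f g).
Implicit Types (f g : T -> R) (s : seq I).

(** A list of weighted indices, possibly with repetitions, makes sums of
combinations immediate; [lin_span_uniq] removes the repetitions. *)
Definition lin_span (t : T -> R) :=
  exists l : seq (R * I), t = (fun x => \sum_(p <- l) p.1 * h p.2 x).

Lemma lin_spanD (t u : T -> R) :
  lin_span t -> lin_span u -> lin_span (fun x => t x + u x).
Proof.
move=> [l ->] [m ->]; exists (l ++ m).
by apply/funext => x; rewrite big_cat.
Qed.

Lemma lin_spanZ c t : lin_span t -> lin_span (fun x => c * t x).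
Proof.
move=> [l ->]; exists [seq (c * p.1, p.2) | p <- l].
apply/funext => x; rewrite big_map mulr_sumr.
by apply: eq_bigr => p _; rewrite mulrA.
Qed.

Lemma lin_span_basis i : lin_span (h i).
Proof.
by exists [:: (1, i)]; apply/funext => x; rewrite big_seq1 mul1r.
Qed.

Lemma lin_span_uniq t : lin_span t -> exists s c,
  uniq s /\ t = (fun x => \sum_(i <- s) c i * h i x).
Proof.
move=> [l ->]; pose s := undup [seq p.2 | p <- l].
exists s, (fun i => \sum_(p <- l) (p.2 == i)%:R * p.1).
split; first exact: undup_uniq.
apply/funext => x; under [RHS]eq_bigr do rewrite mulr_suml.
rewrite exchange_big/=; apply: eq_big_seq => p pl.
rewrite (bigD1_seq p.2)/= ?undup_uniq ?mem_undup ?map_f// eqxx mul1r.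
rewrite big1 ?addr0// => i ip.
by rewrite eq_sym (negbTE ip) !mul0r.
Qed.

Hypothesis h2 : forall i, h i \in L2.
Hypothesis hon : forall i j, '[h i, h j] = (i == j)%:R.

(** Completing the square: the orthogonal projection is the best approximation
of f, and the squared distance from f to it is the gap in the Bessel
inequality. *)
Lemma norm_sub_comb f s c : f \in L2 -> uniq s ->
  '[fun x => f x - \sum_(i <- s) c i * h i x,
    fun x => f x - \sum_(i <- s) c i * h i x] =
  '[f, f] - \sum_(i <- s) '[f, h i] ^+ 2 + \sum_(i <- s) (c i - '[f, h i]) ^+ 2.
Proof.
move=> f2 us; have s2 := L2_sum s c h2; have fs2 := L2B f2 s2.
rewrite dotBl// !dotBr// dot_suml// (dotC mu f (fun x => \sum_(i <- s) _)).
rewrite !dot_suml//.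
have -> : \sum_(i <- s) c i * '[h i, fun x => \sum_(j <- s) c j * h j x] =
    \sum_(i <- s) c i ^+ 2.
  apply: eq_big_seq => i si; rewrite dotC dot_suml// (bigD1_seq i)//=.
  rewrite hon eqxx mulr1 big1 ?addr0// => j ji.
  by rewrite hon (negbTE ji) mulr0.
have -> : \sum_(i <- s) (c i - '[f, h i]) ^+ 2 = \sum_(i <- s) c i ^+ 2 -
    2 * (\sum_(i <- s) c i * '[h i, f]) + \sum_(i <- s) '[f, h i] ^+ 2.
  rewrite mulr_sumr -sumrB -big_split/=.
  by apply: eq_bigr => i _; rewrite (dotC mu (h i)); ring.
ring.
Qed.

Hypothesis dense_h : forall f, f \in L2 -> L2_closure mu lin_span f.

(** The Parseval identity, stated as convergence along the finite sets of indices.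
The gap is at most the squared distance to the approximating combination, and
enlarging the set of indices can only decrease it. *)
Lemma parseval_norm f (e : R) : f \in L2 -> 0 < e ->
  exists2 s, uniq s & forall s', uniq s' -> {subset s <= s'} ->
    `|'[f, f] - \sum_(i <- s') '[f, h i] ^+ 2| < e.
Proof.
move=> f2 e0; have [_ /(_ _ e0)[t /lin_span_uniq[s [c [us ->]]] te]] := dense_h f2.
exists s => // s' us' ss'.
have gap_ge0 : 0 <= '[f, f] - \sum_(i <- s') '[f, h i] ^+ 2.
  have := @norm_sub_comb f s' (fun i => '[f, h i]) f2 us'.
  rewrite [X in _ + X]big1 ?addr0 => [<-|i _]; first exact: dot_ge0.
  by rewrite subrr expr0n.
rewrite ger0_norm//; apply: le_lt_trans te.
rewrite norm_sub_comb// -[leLHS]addr0 lerD//; last first.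
  by apply: sumr_ge0 => i _; exact: sqr_ge0.
rewrite lerD2l lerN2 [leRHS](bigID (mem s))/= -[X in _ <= X + _]big_filter.
rewrite [X in _ <= X + _](perm_big s)/=.
  by rewrite lerDl sumr_ge0// => i _; exact: sqr_ge0.
apply: uniq_perm => //; first exact: filter_uniq.
by move=> i; rewrite mem_filter; apply/andP/idP => [[]//|si]; split => //; exact: ss'.
Qed.

(** By polarization: 4 <f, g> is the difference of the squared norms of f + g and
f - g, and likewise for the coefficients. *)
Lemma parseval f g (e : R) : f \in L2 -> g \in L2 -> 0 < e ->
  exists2 s, uniq s & forall s', uniq s' -> {subset s <= s'} ->
    `|'[f, g] - \sum_(i <- s') '[f, h i] * '[g, h i]| < e.
Proof.
move=> f2 g2 e0.
have [s us Ps] := parseval_norm (L2D f2 g2) e0.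
have [t ut Pt] := parseval_norm (L2B f2 g2) e0.
exists (undup (s ++ t)); first exact: undup_uniq.
move=> s' us' sts'.
have sub_s : {subset s <= s'}.
  by move=> i si; apply: sts'; rewrite mem_undup mem_cat si.
have sub_t : {subset t <= s'}.
  by move=> i ti; apply: sts'; rewrite mem_undup mem_cat ti orbT.
have := Ps _ us' sub_s; have := Pt _ us' sub_t.
have fg2 := L2D f2 g2; have fmg2 := L2B f2 g2.
set G := _ - _; set F := (X in _ -> is_true (`|X| < _) -> _).
set K := (X in _ -> _ -> is_true (`|X| < _)).
have FGK : F - G = 4 * K.
  have -> : G = ('[f, f] + '[g, g] - 2 * '[f, g]) -
      \sum_(i <- s') ('[f, h i] - '[g, h i]) ^+ 2.
    congr (_ - _); last by apply: eq_bigr => i _; rewrite dotBl.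
    by rewrite dotBl// !dotBr// (dotC mu g f); ring.
  have -> : F = ('[f, f] + '[g, g] + 2 * '[f, g]) -
      \sum_(i <- s') ('[f, h i] + '[g, h i]) ^+ 2.
    congr (_ - _); last by apply: eq_bigr => i _; rewrite dotDl.
    rewrite dotDl// !(dotC mu _ (fun x => _ + _)) !dotDl// (dotC mu g f); ring.
  have -> : \sum_(i <- s') ('[f, h i] + '[g, h i]) ^+ 2 =
      \sum_(i <- s') ('[f, h i] - '[g, h i]) ^+ 2 +
      4 * \sum_(i <- s') '[f, h i] * '[g, h i].
    by rewrite mulr_sumr -big_split/=; apply: eq_bigr => i _; ring.
  rewrite /K; ring.
rewrite !ltr_norml => /andP[G1 G2] /andP[F1 F2]; apply/andP; split; lra.
Qed.

(** Self-adjointness of the diagonal operator of real eigenvalues lam, with A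
and B in the role of the images of p and q: both inner products expand into
the sum of the lam_i p_i q_i. *)
Lemma dot_adjoint (lam : I -> R) (p q A B : T -> R) :
  p \in L2 -> q \in L2 -> A \in L2 -> B \in L2 ->
  (forall i, '[A, h i] = lam i * '[p, h i]) ->
  (forall i, '[B, h i] = lam i * '[q, h i]) ->
  '[B, p] = '[A, q].
Proof.
move=> p2 q2 A2 B2 Ah Bh; apply/eqP; rewrite -subr_eq0 -normr_le0.
apply/ler_addgt0Pl => e e0; rewrite addr0.
have e20 : 0 < e / 2 by rewrite divr_gt0.
have [s us Ps] := parseval B2 p2 e20.
have [t ut Pt] := parseval A2 q2 e20.
have sub_s : {subset s <= undup (s ++ t)}.
  by move=> i si; rewrite mem_undup mem_cat si.
have sub_t : {subset t <= undup (s ++ t)}.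
  by move=> i ti; rewrite mem_undup mem_cat ti orbT.
have := Ps _ (undup_uniq _) sub_s; have := Pt _ (undup_uniq _) sub_t.
have -> : \sum_(i <- undup (s ++ t)) '[A, h i] * '[q, h i] =
          \sum_(i <- undup (s ++ t)) '[B, h i] * '[p, h i].
  by apply: eq_bigr => i _; rewrite Ah Bh; ring.
set S := \sum_(i <- _) _ => AS BS.
have -> : '[B, p] - '[A, q] = ('[B, p] - S) - ('[A, q] - S) by ring.
by rewrite (le_trans (ler_normB _ _))// [e]splitr lerD// ltW.
Qed.

End orthonormal.

(** * Integrals of cosines over a box *)

Section cosine_integral.
Context {R : realType}.

Lemma measurable_phase n (xi : 'I_n -> R) :
  measurable_fun setT (fun x : Rpoint R n => \sum_i xi i * tnth x i).
Proof.
by apply: measurable_sum => i; apply: measurable_funM => //; exact: measurable_tnth.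
Qed.

Lemma measurable_cos_phase n (th : R) (xi : 'I_n -> R) :
  measurable_fun setT (fun x : Rpoint R n => cos (th + \sum_i xi i * tnth x i)).
Proof.
apply: (measurableT_comp (f := cos)).
  by apply: continuous_measurable_fun; exact: continuous_cos.
by apply: measurable_funD => //; exact: measurable_phase.
Qed.

Lemma lebesgue_dim_box n (a b : 'I_n -> R) : (forall i, a i < b i) ->
  lebesgue_dim n (box a b) = (\prod_i (b i - a i))%:E.
Proof.
move=> ab; have -> : box a b = [set x | forall i, `]a i, b i[%classic (tnth x i)].
  by apply/seteqP; split => x /= xab i; move: (xab i); rewrite in_itv.
rewrite (lebesgue_dim_prod (A := fun i => `]a i, b i[%classic))//.
rewrite -prodEFin; apply: eq_bigr => i _.
by rewrite lebesgue_measure_itv/= lte_fin ab.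
Qed.

(** By Fubini, one coordinate in which every translate of the cosine has zero mean
is enough. The phase th is arbitrary in order to absorb the other coordinates
in the induction on the dimension. *)
Lemma integral_box_cos n (a b xi : 'I_n -> R) (i : 'I_n) :
  (forall i, a i < b i) ->
  (forall th : R,
    \int[@lebesgue_measure R]_(t in `]a i, b i[) (cos (th + xi i * t))%:E = 0)%E ->
  forall th, (\int[lebesgue_dim n]_(x in box a b)
    (cos (th + \sum_i xi i * tnth x i))%:E = 0)%E.
Proof.
elim: n a b xi i => [|n IH] a b xi i ab cos0 th; first by case: i {cos0}.
pose a' j := a (lift ord0 j); pose b' j := b (lift ord0 j).
pose xi' j := xi (lift ord0 j).
pose A := `]a ord0, b ord0[%classic : set (measurableTypeR R).
have mAB : measurable (A `*` box a' b').
  by apply: measurableX; [exact: measurable_itv|exact: measurable_box].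
have preim : @point_cons R n @^-1` (box a b) = A `*` box a' b'.
  apply/seteqP; split => -[t x] /=.
    move=> h; split; first by rewrite /A/= in_itv; exact: (h ord0).
    by move=> j; have := h (lift ord0 j); rewrite !(tnth_nth t).
  move=> [/=]; rewrite /A/= in_itv/= => tA xB j.
  by case: (unliftP ord0 j) => [l ->|->//]; have := xB l; rewrite !(tnth_nth t).
pose f (z : measurableTypeR R * Rpoint R n) : R :=
  cos (th + xi ord0 * z.1 + \sum_j xi' j * tnth z.2 j).
have mf : measurable_fun setT f.
  apply: (measurableT_comp (f := cos)).
    by apply: continuous_measurable_fun; exact: continuous_cos.
  apply: measurable_funD.
    by apply: measurable_funD => //; apply: measurable_funM.
  exact: (measurableT_comp (measurable_phase xi')).
have fE t x : cos (th + \sum_i xi i * tnth (point_cons (t, x)) i) = f (t, x).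
  rewrite big_ord_recl addrA /f; congr (cos (_ + _ + _)).
  by apply: eq_bigr => j _; rewrite !(tnth_nth t).
have finAB : ((@lebesgue_measure R \x lebesgue_dim n) (A `*` box a' b') < +oo)%E.
  rewrite product_measure1E; [|exact: measurable_itv|exact: measurable_box].
  rewrite lebesgue_dim_box; last by move=> j; exact: ab.
  rewrite [X in (X * _ < _)%E](_ : _ = (b ord0 - a ord0)%:E) ?ltry//.
  by rewrite -[LHS]/(@lebesgue_measure R A) lebesgue_measure_itv/= lte_fin ab.
have int_f : ((@lebesgue_measure R \x lebesgue_dim n)%E).-integrable
    (A `*` box a' b') (EFin \o f).
  apply: measurable_bounded_integrable => //; first exact: measurable_funTS.
  exists 1; split; first exact: num_real.
  by move=> M M1 z _ /=; rewrite (le_trans _ (ltW M1))// ler_norml cos_geN1 cos_le1.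
rewrite /= /lebesgue_step integral_pushforward; last 4 first.
- exact: measurable_point_cons.
- by apply/measurable_EFinP; exact: measurable_cos_phase.
- by rewrite preim; apply: eq_integrable int_f => //= -[t x] _ /=; rewrite fE.
- exact: measurable_box.
rewrite preim (eq_integral (EFin \o f)); last first.
  by move=> -[t x] _ /=; rewrite fE.
rewrite integral_mkcond.
have int_g := (integrable_mkcond (EFin \o f) mAB).1 int_f.
have gE t x : ((EFin \o f) \_ (A `*` box a' b')) (t, x) =
    (if t \in A then if x \in box a' b' then (f (t, x))%:E else 0 else 0)%E.
  by rewrite patchE in_setX/=; case: (t \in A).
(* The coordinate with zero mean is integrated first: by the induction hypothesis
   if it is among the last n ones, directly if it is the first one. *)
case: (unliftP ord0 i) cos0 => [j ->|->] cos0.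
  rewrite -integral12_prod_meas1//.
  apply: integral0_eq => t _ /=; rewrite /fubini_F.
  under eq_integral do rewrite gE.
  case: (t \in A); last by rewrite integral0.
  apply: etrans (IH a' b' xi' j (fun l => ab _) cos0 (th + xi ord0 * t)).
  by rewrite [RHS]integral_mkcond; apply: eq_integral => x _; rewrite patchE.
rewrite -integral21_prod_meas1//.
apply: integral0_eq => x _ /=; rewrite /fubini_G.
have [xB|xB] := boolP (x \in box a' b'); last first.
  rewrite -[RHS](integral0 (@lebesgue_measure R) setT); apply: eq_integral => t _.
  by rewrite gE (negbTE xB) if_same.
apply: etrans (cos0 (th + \sum_j xi' j * tnth x j)).
rewrite [RHS]integral_mkcond; apply: eq_integral => t _.
by rewrite gE xB patchE; case: ifP => // _; rewrite /f/= addrAC.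
Qed.

Lemma sin_periodz (x : R) (k : int) : sin (x + 2 * pi * k%:~R) = sin x.
Proof.
have E n y : sin (y + 2 * pi * n%:R) = sin y :> R.
  rewrite (_ : 2 * pi * n%:R = pi *+ 2 *+ n); first exact: periodicn (@sinD2pi R) _ _.
  by rewrite mulrC mulr_natl mulr_natl.
case: k => n; first by rewrite -pmulrn E.
by rewrite NegzE mulrNz mulrN -[LHS](E n.+1) -pmulrn subrK.
Qed.

Lemma cos_periodz (x : R) (k : int) : cos (x + 2 * pi * k%:~R) = cos x.
Proof. by rewrite -!sinDpihalf (addrAC x) sin_periodz. Qed.

Lemma integral_itv_cos (a b th xi : R) (k : int) : a < b -> k != 0 ->
  xi * (b - a) = 2 * pi * k%:~R ->
  (\int[@lebesgue_measure R]_(t in `]a, b[) (cos (th + xi * t))%:E = 0)%E.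
Proof.
move=> ab k0 xik.
have xi0 : xi != 0.
  apply: contra_neq (k0) => xi0; move: xik; rewrite xi0 mul0r => /esym/eqP.
  by rewrite !mulf_eq0 pnatr_eq0/= gt_eqF ?pi_gt0//= intr_eq0 => /eqP.
pose G t : R := xi^-1 * sin (th + xi * t).
have dG (t : R) : is_derive t 1 G (cos (th + xi * t)).
  rewrite /G; apply: is_derive_eq.
  by rewrite /GRing.scale/=; field.
have cG t : {for t, continuous G}.
  by apply: differentiable_continuous; apply/derivable1_diffP; case: (dG t).
have cc : continuous (fun t : R => cos (th + xi * t)).
  move=> t; apply: continuous_comp; last exact: continuous_cos.
  by apply: cvgD; [exact: cvg_cst|apply: cvgM; [exact: cvg_cst|exact: cvg_id]].
rewrite -(@integral_itv_bndoo _ a b _ true false); last first.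
  apply/measurable_EFinP; apply: measurable_funTS.
  exact: continuous_measurable_fun.
rewrite (@continuous_FTC2 _ _ G)//.
- rewrite /G -EFinB; congr EFin.
  have -> : th + xi * b = th + xi * a + 2 * pi * k%:~R by rewrite -xik; ring.
  by rewrite sin_periodz subrr.
- exact: continuous_subspaceT.
- split=> [x _||]; first by case: (dG x).
  + exact/cvg_at_right_filter/cG.
  + exact/cvg_at_left_filter/cG.
- by move=> x _; rewrite derive1E; case: (dG x).
Qed.

End cosine_integral.

(** * The Hartley functions and the trigonometric polynomials *)

Section hartley.
Context {R : realType} {d : nat} (a b : 'I_d -> R).
Hypothesis ab : forall i, a i < b i.
Local Notation mu := (box_measure a b).
Local Notation L2 := (Lfun mu 2%:E).
Local Notation freq := {ffun 'I_d -> int}.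
Local Notation vol := (volume a b).
Implicit Types (k l : freq) (x : Rpoint R d) (th : R).

Lemma volume_gt0 : 0 < vol.
Proof. by apply: prodr_gt0 => i _; rewrite subr_gt0. Qed.

Lemma box_measure_setT : mu setT = vol%:E.
Proof. by rewrite /= /mrestr setTI (lebesgue_dim_box ab). Qed.

Lemma box_measure_fin : (mu setT < +oo)%E.
Proof. by rewrite box_measure_setT; exact: ltry. Qed.

Lemma ae_box : {ae mu, forall x, box a b x}.
Proof.
exists (~` box a b); split=> //; first exact: measurableC (measurable_box a b).
by rewrite /= /mrestr setICl measure0.
Qed.

Lemma wavenumberE k i : wavenumber a b k i * (b i - a i) = 2 * pi * (k i)%:~R.
Proof. by rewrite /wavenumber divfK// subr_eq0 gt_eqF. Qed.

Lemma phaseD k l x : phase a b (k + l) x = phase a b k x + phase a b l x.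
Proof.
rewrite /phase -big_split/=; apply: eq_bigr => i _.
by rewrite /wavenumber ffunE intrD; ring.
Qed.

Lemma phaseN k x : phase a b (- k) x = - phase a b k x.
Proof.
rewrite /phase -sumrN; apply: eq_bigr => i _.
by rewrite /wavenumber ffunE intrN; ring.
Qed.

Lemma phase0 x : phase a b 0 x = 0.
Proof. by rewrite /phase big1// => i _; rewrite /wavenumber ffunE mulr0 !mul0r. Qed.

Lemma L2_cos th k : (fun x => cos (th + phase a b k x)) \in L2.
Proof.
apply: (L2_bounded box_measure_fin (M := 1)); first exact: measurable_cos_phase.
by move=> x; rewrite ler_norml cos_geN1 cos_le1.
Qed.

Lemma Rintegral_cos_phase th k : k != 0 ->
  \int[mu]_x cos (th + phase a b k x) = 0.
Proof.
move=> k0; have [i ki] : exists i, k i != 0.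
  apply: contrapT => nk; move/eqP: k0; apply; apply/ffunP => i.
  by rewrite ffunE; apply/eqP; apply: contra_notT nk => ki; exists i.
suff I0 : (\int[mu]_x (cos (th + phase a b k x))%:E = 0)%E by rewrite /Rintegral I0.
have mbox := measurable_box a b.
have intc : mu.-integrable setT (fun x => (cos (th + phase a b k x))%:E).
  apply: measurable_bounded_integrable => //.
  - exact: box_measure_fin.
  - exact: measurable_cos_phase.
  - exists 1; split; first exact: num_real.
    by move=> M M1 x _ /=; rewrite (le_trans _ (ltW M1))// ler_norml cos_geN1 cos_le1.
rewrite (@negligible_integral _ _ _ mu _ (~` box a b))//; last 2 first.
- exact: measurableC.
- by rewrite /= /mrestr setICl measure0.
rewrite setTD setCK (eq_measure_integral (lebesgue_dim d)); last first.
  by move=> A mA Abox; rewrite /= /mrestr setIidl.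
apply: (integral_box_cos (i := i)) => // th'.
exact: (integral_itv_cos th' (ab i) ki (wavenumberE k i)).
Qed.

(** Up to normalization this is cos + sin of the phase, the kernel of the
Hartley transform: a single real orthonormal family indexed by Z^d, in place
of the complex exponentials. *)
Definition hartley k x := Num.sqrt (2 / vol) * cos (- (pi / 4) + phase a b k x).

Lemma cosM (s t : R) : cos s * cos t = (cos (s - t) + cos (s + t)) / 2.
Proof. by rewrite cosB cosD; field. Qed.

Lemma hartleyM k l x : hartley k x * hartley l x =
  vol^-1 * (cos (0 + phase a b (k - l) x) + cos (- (pi / 2) + phase a b (k + l) x)).
Proof.
rewrite /hartley mulrACA -expr2 sqr_sqrtr; last first.
  by rewrite divr_ge0// ltW// volume_gt0.
rewrite cosM !phaseD phaseN.
set A := phase a b k x; set B := phase a b l x.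
have -> : - (pi / 4) + A - (- (pi / 4) + B) = 0 + (A - B) by ring.
have -> : - (pi / 4) + A + (- (pi / 4) + B) = - (pi / 2) + (A + B) by field.
by field; rewrite gt_eqF ?volume_gt0.
Qed.

Lemma L2_hartley k : hartley k \in L2.
Proof. exact/L2Z/L2_cos. Qed.

Lemma integrable_cos th k :
  mu.-integrable setT (EFin \o (fun x => cos (th + phase a b k x))).
Proof.
by apply/(Lfun1_integrable mu _).1/Lfun_subset12; rewrite ?box_measure_setT ?L2_cos.
Qed.

(** In [hartleyM] the first cosine has zero mean unless k = l. The second one
has zero mean unless k + l = 0, and then it is the constant cos (- pi / 2) = 0:
this is what the shift by pi / 4 is for. *)
Lemma hartley_orthonormal k l : dot mu (hartley k) (hartley l) = (k == l)%:R.
Proof.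
rewrite /dot; under eq_Rintegral do rewrite hartleyM.
have i1 := integrable_cos 0 (k - l); have i2 := integrable_cos (- (pi / 2)) (k + l).
rewrite RintegralZl//; last exact: (integrableD _ i1 i2).
rewrite RintegralD// [X in _ + X](_ : _ = 0) ?addr0; last first.
  have [kl0|] := eqVneq (k + l) 0; last exact: Rintegral_cos_phase.
  under eq_Rintegral do rewrite kl0 phase0 addr0 cosN cos_pihalf.
  by rewrite Rintegral_cst// mul0r.
have [->|kl] := eqVneq k l; last first.
  by rewrite Rintegral_cos_phase ?mulr0// subr_eq0.
under eq_Rintegral do rewrite subrr phase0 addr0 cos0.
by rewrite Rintegral_cst// box_measure_setT/= mul1r mulVf// gt_eqF ?volume_gt0.
Qed.

Local Notation trig := (lin_span hartley).

(** Expanding around the shift by - pi / 4 gives a cosine, proportional to h_k, and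
a sine, proportional to h_(-k) by parity. *)
Lemma trig_cos th k : trig (fun x => cos (th + phase a b k x)).
Proof.
have -> : (fun x => cos (th + phase a b k x)) = (fun x =>
    cos (th + pi / 4) / Num.sqrt (2 / vol) * hartley k x +
    sin (th + pi / 4) / Num.sqrt (2 / vol) * hartley (- k) x).
  apply/funext => x; rewrite /hartley phaseN.
  set A := phase a b k x; set c := Num.sqrt _.
  have c0 : c != 0 by rewrite sqrtr_eq0 -ltNge divr_gt0// volume_gt0.
  have -> : cos (- (pi / 4) - A) = - sin (- (pi / 4) + A).
    by rewrite -cosDpihalf -cosN; congr cos; field.
  have -> : th + A = (th + pi / 4) + (- (pi / 4) + A) by ring.
  by rewrite cosD; field.
by apply: lin_spanD; apply: lin_spanZ; exact: lin_span_basis.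
Qed.

Lemma trig_cst c : trig (fun=> c).
Proof.
have -> : (fun=> c) = (fun x => c * cos (0 + phase a b 0 x)).
  by apply/funext => x; rewrite phase0 addr0 cos0 mulr1.
exact/lin_spanZ/trig_cos.
Qed.

Lemma trigM s t : trig s -> trig t -> trig (fun x => s x * t x).
Proof.
move=> [l ->] [m ->].
have trig_sum I (r : seq I) (F : I -> Rpoint R d -> R) :
    (forall i, trig (F i)) -> trig (fun x => \sum_(i <- r) F i x).
  move=> trigF; elim: r => [|i r IH].
    have -> : (fun x => \sum_(i <- [::]) F i x) = (fun=> 0).
      by apply/funext => x; rewrite big_nil.
    exact: trig_cst.
  by under eq_fun do rewrite big_cons; exact: lin_spanD.
have -> : (fun x => (\sum_(p <- l) p.1 * hartley p.2 x) *
      (\sum_(q <- m) q.1 * hartley q.2 x)) =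
    (fun x => \sum_(p <- l) \sum_(q <- m)
      p.1 * q.1 / vol * (cos (0 + phase a b (p.2 - q.2) x) +
                         cos (- (pi / 2) + phase a b (p.2 + q.2) x))).
  apply/funext => x; rewrite big_distrlr/=.
  apply: eq_bigr => p _; apply: eq_bigr => q _.
  by rewrite mulrACA hartleyM mulrA.
apply: (trig_sum) => p; apply: trig_sum => q.
by apply/lin_spanZ/lin_spanD; exact: trig_cos.
Qed.

Lemma trigX t n : trig t -> trig (fun x => t x ^+ n).
Proof.
move=> trigt; elim: n => [|n IH]; first exact: trig_cst.
by under eq_fun do rewrite exprS; exact: trigM.
Qed.

(** For a_i < be < b_i the witness is the product of 2 sin (pi (x_i - a_i) / L)
and sin (pi (x_i - be) / L) with L = b_i - a_i: on the box the first sine is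
positive and the second one has the sign of x_i - be. Expanded into cosines,
the product only involves the period L. For the other values of be the sign is
constant on the box. *)
Lemma trig_sign (i : 'I_d) (be : R) : exists g, [/\ trig g,
  forall x, `|g x| <= 2 &
  forall x, box a b x -> (0 < g x) = (be < tnth x i)].
Proof.
have [bea|abe] := leP be (a i).
  exists (fun=> 1); split; first exact: trig_cst.
    by move=> x; rewrite normr1 ler1n.
  by move=> x /(_ i)/andP[ax _]; rewrite ltr01 (le_lt_trans bea).
have [bbe|beb] := leP (b i) be.
  exists (fun=> -1); split; first exact: trig_cst.
    by move=> x; rewrite normrN1 ler1n.
  by move=> x /(_ i)/andP[_ xb]; rewrite oppr_gt0 ltr10 ltNge (le_trans (ltW xb)).
pose L := b i - a i; have L0 : 0 < L by rewrite subr_gt0.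
pose k : freq := [ffun j => (j == i)%:Z].
have phk x : phase a b k x = 2 * pi / L * tnth x i.
  rewrite /phase (bigD1 i)//= big1 => [|j ji].
    by rewrite addr0 /wavenumber ffunE eqxx mulr1.
  by rewrite /wavenumber ffunE (negbTE ji) mulr0 !mul0r.
pose th := - (pi * (a i + be) / L).
exists (fun x => cos (pi * (be - a i) / L) + (-1) * cos (th + phase a b k x)).
split.
- by apply: lin_spanD; [exact: trig_cst|exact/lin_spanZ/trig_cos].
- move=> x; rewrite mulN1r (le_trans (ler_normB _ _))//.
  by rewrite [leRHS](_ : 2 = 1 + 1)// lerD// ler_norml cos_geN1 cos_le1.
- move=> x /(_ i)/andP[ax xb].
  pose u := pi * (tnth x i - a i) / L; pose v := pi * (tnth x i - be) / L.
  have -> : pi * (be - a i) / L = u - v by rewrite /u /v; field; rewrite gt_eqF.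
  have -> : th + phase a b k x = u + v.
    by rewrite phk /th /u /v; field; rewrite gt_eqF.
  have -> : cos (u - v) + -1 * cos (u + v) = 2 * sin u * sin v.
    by rewrite cosB cosD; ring.
  have pi0 := pi_gt0 R.
  have su : 0 < sin u.
    apply: sin_gt0_pi; rewrite divr_gt0 ?mulr_gt0 ?subr_gt0//=.
    by rewrite ltr_pdivrMr// ltr_pM2l// ltrD2r.
  rewrite pmulr_rgt0; last by rewrite mulr_gt0.
  have [bex|xbe|xbe] := ltgtP be (tnth x i).
  + apply: sin_gt0_pi; rewrite divr_gt0 ?mulr_gt0 ?subr_gt0//=.
    by rewrite ltr_pdivrMr// ltr_pM2l// ltr_leB// ltW.
  + apply/negbTE; rewrite -leNgt -oppr_ge0 -sinN.
    have -> : - v = pi * (be - tnth x i) / L by rewrite /v; field; rewrite gt_eqF.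
    apply: sin_ge0_pi; rewrite divr_ge0 ?mulr_ge0 ?subr_ge0 ?ltW//=.
    by rewrite ltr_pdivrMr// ltr_pM2l//; rewrite /L; lra.
  + by rewrite /v xbe subrr mulr0 mul0r sin0 ltxx.
Qed.

End hartley.

(** * Completeness of the Hartley functions *)

Section step_polynomial.
Context {R : realType}.

(** Polynomials in h that converge on [0, 1] to the indicator of h < 1/2. The
exponent 2^n would be enough away from 1/2; the additional factor n makes the
limit zero at h = 1/2, where (1 - 2^-n)^(2^n) tends to 1/e. *)
Definition step_poly (n : nat) (h : R) : R := (1 - h ^+ n) ^+ (n * 2 ^ n).

Lemma step_poly_itv n (h : R) : 0 <= h <= 1 -> 0 <= step_poly n h <= 1.
Proof.
move=> /andP[h0 h1]; have hn1 : h ^+ n <= 1 by rewrite exprn_ile1.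
have hn0 : 0 <= h ^+ n by rewrite exprn_ge0.
by rewrite exprn_ge0 ?subr_ge0// exprn_ile1 ?subr_ge0// gerBl.
Qed.

Lemma bernoulli (t : R) n : -1 <= t -> 1 + n%:R * t <= (1 + t) ^+ n.
Proof.
move=> t1; elim: n => [|n IH]; first by rewrite mul0r addr0 expr0.
have t10 : 0 <= 1 + t by lra.
rewrite exprS; apply: le_trans (ler_wpM2l t10 IH).
rewrite -natr1 -subr_ge0 (_ : _ - _ = n%:R * t ^+ 2); last by ring.
by rewrite mulr_ge0 ?ler0n ?sqr_ge0.
Qed.

(** The error is at most n (2h)^n. With y^2 >= 2h and y < 1 it is at most
(n y^n) y^n, where n y^n is bounded. *)
Lemma cvg_step_poly_lt (h : R) : 0 <= h -> h < 2^-1 ->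
  step_poly ^~ h @ \oo --> (1 : R).
Proof.
move=> h0 h2.
have [y [y0 y1 hy]] : exists y, [/\ 0 < y, y < 1 & 2 * h <= y ^+ 2].
  (* The midpoint of 2h and 1 works by the inequality between the arithmetic
     and the geometric mean. *)
  exists ((1 + 2 * h) / 2); split; [lra|lra|].
  rewrite -subr_ge0 [leRHS](_ : _ = ((1 - 2 * h) / 2) ^+ 2) ?sqr_ge0//.
  by field.
have ny n : n%:R * y ^+ n <= (1 - y)^-1.
  have := @bernoulli (y^-1 - 1) n; rewrite subrKC => B.
  have {}B : n%:R * (y^-1 - 1) <= y^-1 ^+ n.
    apply: le_trans (B _); first by rewrite lerDr.
    by rewrite lerBrDr addNr invr_ge0 ltW.
  rewrite -div1r ler_pdivlMr ?subr_gt0//.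
  rewrite exprVn -[leRHS]div1r ler_pdivlMr ?exprn_gt0// in B.
  apply: le_trans B; rewrite mulrAC ler_wpM2r ?exprn_ge0 ?(ltW y0)//.
  rewrite ler_wpM2l// -subr_ge0.
  rewrite (_ : _ - _ = (1 - y) ^+ 2 / y) ?divr_ge0 ?sqr_ge0 ?(ltW y0)//.
  by field; rewrite gt_eqF.
apply: (@squeeze_cvgr _ _ _ _ (fun n => 1 - (1 - y)^-1 * y ^+ n) (fun=> 1)).
- apply: nearW => n; have h01 : 0 <= h <= 1 by apply/andP; split; lra.
  have /andP[_ ->] := step_poly_itv n h01; rewrite andbT.
  have hn1 : h ^+ n <= 1 by rewrite exprn_ile1//; lra.
  apply: le_trans (@bernoulli (- h ^+ n) (n * 2 ^ n) _); last by rewrite lerN2.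
  rewrite mulrN lerD2l lerN2 natrM natrX -mulrA -exprMn.
  apply: le_trans (ler_wpM2r (exprn_ge0 n (ltW y0)) (ny n)).
  rewrite -mulrA -exprD addnn -mul2n exprM ler_wpM2l// lerXn2r// nnegrE ?sqr_ge0//.
  by rewrite mulr_ge0.
- rewrite -[X in _ --> X]subr0; apply: cvgB; first exact: cvg_cst.
  rewrite -[X in _ --> X](mulr0 (1 - y)^-1); apply: cvgM; first exact: cvg_cst.
  by apply: cvg_expr; rewrite gtr0_norm.
- exact: cvg_cst.
Qed.

(** Since (1 - t) (1 + t) <= 1, the inner power is at most the inverse of
(1 + h^n)^(2^n), which is at least 2. *)
Lemma cvg_step_poly_ge (h : R) : 2^-1 <= h -> h <= 1 ->
  step_poly ^~ h @ \oo --> (0 : R).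
Proof.
move=> h2 h1.
have h0 : 0 <= h by lra.
apply: (@squeeze_cvgr _ _ _ _ (fun=> 0) (fun n => 2^-1 ^+ n)).
- apply: nearW => n; have h01 : 0 <= h <= 1 by apply/andP; split; lra.
  have /andP[-> _]/= := step_poly_itv n h01.
  have t0 : 0 <= h ^+ n by rewrite exprn_ge0.
  have t1 : 0 <= 1 - h ^+ n by rewrite subr_ge0 exprn_ile1.
  rewrite /step_poly mulnC exprM lerXn2r ?nnegrE ?exprn_ge0//.
  have N2 : 2 <= (1 + h ^+ n) ^+ (2 ^ n).
    apply: le_trans (bernoulli _ _); last by rewrite (le_trans _ t0)// lerN10.
    rewrite natrX -exprMn [leLHS](_ : 2 = 1 + 1)// lerD2l exprn_ege1//; lra.
  rewrite -div1r ler_pdivlMr//; apply: le_trans (ler_wpM2l _ N2) _.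
    by rewrite exprn_ge0.
  rewrite -exprMn exprn_ile1//.
    by rewrite mulr_ge0// addr_ge0.
  by rewrite -subr_sqr expr1n gerBl sqr_ge0.
- exact: cvg_cst.
- by apply: cvg_expr; rewrite gtr0_norm//; lra.
Qed.

End step_polynomial.

Section dense.
Context {R : realType} {d : nat} (a b : 'I_d -> R).
Hypothesis ab : forall i, a i < b i.
Local Notation mu := (box_measure a b).
Local Notation L2 := (Lfun mu 2%:E).
Local Notation trig := (lin_span (hartley a b)).

Definition orthant (s : seq ('I_d * R)) : set (Rpoint R d) :=
  [set x | forall p, p \in s -> p.2 < tnth x p.1].

Lemma orthantI s t : orthant s `&` orthant t = orthant (s ++ t).
Proof.
apply/seteqP; split => x /=.
  by move=> [sx tx] p; rewrite mem_cat => /orP[/sx|/tx].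
by move=> stx; split=> p pst; apply: stx; rewrite mem_cat pst ?orbT.
Qed.

Lemma measurable_orthant s : measurable (orthant s).
Proof.
elim: s => [|p s IH].
  have -> : orthant [::] = setT by apply/seteqP; split.
  exact: measurableT.
have -> : orthant (p :: s) =
    (fun x : Rpoint R d => tnth x p.1) @^-1` `]p.2, +oo[%classic `&` orthant s.
  apply/seteqP; split => x /=.
    move=> psx; split; first by rewrite in_itv/= psx// mem_head.
    by move=> q qs; apply: psx; rewrite inE qs orbT.
  by rewrite in_itv/= andbT => -[px sx] q; rewrite inE => /predU1P[->//|/sx].
apply: measurableI => //.
rewrite -[X in measurable X]setTI; apply: measurable_tnth => //.
Qed.

Lemma measurable_generated_by_orthants :
  (measurable : set (set (Rpoint R d))) = <<s range orthant >>.
Proof.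
apply/seteqP; split; last first.
  apply: smallest_sub; first exact: sigma_algebra_measurable.
  by move=> _ [s _ <-]; exact: measurable_orthant.
apply: smallest_sub; first exact: smallest_sigma_algebra.
have gen (i : 'I_d) : preimage_set_system setT (fun x : Rpoint R d => tnth x i)
    measurable `<=` <<s range orthant >>.
  have sI := sigma_algebra_image (fun x : Rpoint R d => tnth x i)
    (smallest_sigma_algebra setT (range orthant)).
  move=> _ [B mB <-].
  suff : image_set_system setT (fun x : Rpoint R d => tnth x i)
    <<s range orthant >> B by [].
  have : (@RGenOInfty.G R).-sigma.-measurable B by rewrite -RGenOInfty.measurableE.
  apply: smallest_sub => // _ [r ->]; apply: sub_sigma_algebra.
  exists [:: (i, r)] => //; rewrite setTI; apply/seteqP; split => x /=.
    by move=> /(_ (i, r)); rewrite in_itv/= andbT; apply; exact: mem_head.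
  by rewrite in_itv/= andbT => rx p; rewrite inE => /eqP ->.
elim/big_ind : _ => //; first by move=> A B sA sB; rewrite subUset.
Qed.

(** One step polynomial for each half-space of the intersection; the products stay
between 0 and 1, which makes the convergence bounded. *)
Lemma trig_orthant s : exists f_ : (Rpoint R d -> R)^nat,
  [/\ forall n, trig (f_ n), forall n x, 0 <= f_ n x <= 1 &
      forall x, box a b x -> f_ ^~ x @ \oo --> (\1_(orthant s) x : R)].
Proof.
elim: s => [|[i be] s [f_ [trigf f01 f_f]]].
  exists (fun _ _ => 1); split=> [n|n x|x _]; first exact: trig_cst.
    by rewrite ler01 lexx.
  by rewrite indicE mem_set//; exact: cvg_cst.
have [g [trigg g2 g_sign]] := trig_sign ab i be.
(* This maps [-2, 2] onto [0, 1] and turns 0 < g x into h x < 1/2. *)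
pose h x := 2^-1 - g x / 4.
have h01 x : 0 <= h x <= 1.
  by have := g2 x; rewrite ler_norml => /andP[? ?]; rewrite /h; apply/andP; split; lra.
exists (fun n x => step_poly n (h x) * f_ n x); split=> [n|n x|x boxx].
- apply: trigM => //; apply: trigX => //.
  have -> : (fun x => 1 - h x ^+ n) = (fun x => 1 + (-1) * h x ^+ n).
    by apply/funext => x; rewrite mulN1r.
  apply: lin_spanD; first exact: trig_cst.
  apply/lin_spanZ/trigX => //.
  have -> : h = (fun x => 2^-1 + (- 4^-1) * g x).
    by apply/funext => x; rewrite /h; ring.
  by apply: lin_spanD; [exact: trig_cst|exact: lin_spanZ].
- have /andP[p0 p1] := step_poly_itv n (h01 x); have /andP[f0 f1] := f01 n x.
  by rewrite mulr_ge0//= mulr_ile1.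
- have -> : \1_(orthant ((i, be) :: s)) x = (be < tnth x i)%R%:R * \1_(orthant s) x :> R.
    rewrite !indicE -natrM mulnb; congr (nat_of_bool _)%:R.
    apply/idP/andP; rewrite !inE.
      move=> psx; split; first by apply: (psx (i, be)); exact: mem_head.
      by move=> q qs; apply: psx; rewrite inE qs orbT.
    by move=> [px sx] q; rewrite inE => /predU1P[->//|/sx].
  apply: cvgM; last exact: f_f.
  have /andP[h0 h1] := h01 x.
  rewrite -g_sign//; case: ltP => gx.
    by apply: cvg_step_poly_lt => //; rewrite /h; lra.
  by apply: cvg_step_poly_ge => //; rewrite /h; lra.
Qed.

Lemma hartley_dense f : f \in L2 -> L2_closure mu trig f.
Proof.
have fin := box_measure_fin ab.
have trig2 t : trig t -> t \in L2.
  by move=> [l ->]; exact: (L2_sum l fst (fun p => L2_hartley ab p.2)).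
apply: (@L2_closure_full _ _ _ mu trig _ _ _ fin _ (range orthant)).
- exact: trig2.
- exact: lin_spanD.
- exact: lin_spanZ.
- exact: trig_cst.
- by move=> _ _ [s _ <-] [t _ <-]; rewrite orthantI; exists (s ++ t).
- exact: measurable_generated_by_orthants.
- move=> _ [s _ <-]; have [f_ [trigf f01 f_f]] := trig_orthant s.
  apply: (@L2_closure_lim _ _ _ mu trig _ f_ _ (fun=> 1)).
  + exact: trig2.
  + by move=> n; apply: sub_L2_closure => //; exact: trig2.
  + apply: L2_indic => //; exact: measurable_orthant.
  + exact/trig2/trig_cst.
  + by move=> n x; have /andP[f0 f1] := f01 n x; rewrite ger0_norm.
  + by apply: filterS (ae_box a b) => x; exact: f_f.
Qed.

End dense.

(** * The weak Laplacian in the Hartley basis *)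

Section plane_wave.
Context {R : realType} {d : nat}.
Implicit Types (xi : 'I_d -> R) (z v : 'rV[R]_d).

(** A family that is stable under partial derivatives, each of which multiplies
the amplitude by a wave number and shifts the phase by pi / 2. *)
Definition wave (c th : R) xi z : R := c * cos (th + \sum_j xi j * z 0 j).

Lemma is_derive_wave c th xi z (i : 'I_d) :
  is_derive z (delta_mx 0 i) (wave c th xi) (wave (c * xi i) (th + pi / 2) xi z).
Proof.
set v := delta_mx 0 i.
(* G is the restriction of the wave to the line through z directed by v. *)
pose G (t : R) : R := c * cos (th + \sum_j xi j * z 0 j + xi i * t).
have dG : is_derive (0 : R) 1 G (wave (c * xi i) (th + pi / 2) xi z).
  rewrite /G; apply: is_derive_eq.
  rewrite /wave (addrAC th (pi / 2)) cosDpihalf /GRing.scale/= mulr0 addr0; ring.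
have GE : (fun h : R => h^-1 *: ((G \o shift (0 : R)) (h *: (1 : R)) - G 0)) =
    (fun h : R => h^-1 *: ((wave c th xi \o shift z) (h *: v) - wave c th xi z)).
  apply/funext => h; congr (_ *: (_ - _)); last by rewrite /G mulr0 addr0.
  rewrite /= /G /wave addr0 [h *: 1]mulr1 -addrA; congr (c * cos (th + _)).
  rewrite (bigD1 i)//= [RHS](bigD1 i)//= !mxE !eqxx/= mulr1 mulrDr.
  rewrite addrAC [_ + xi i * h]addrC; congr (_ + _).
  by apply: eq_bigr => j ji; rewrite !mxE (negbTE ji) andbF mulr0 add0r.
by case: dG => dG1 dG2; split; [move: dG1|move: dG2]; rewrite /derivable /derive GE.
Qed.

Lemma partial_wave c th xi (i : 'I_d) :
  partial i (wave c th xi) = wave (c * xi i) (th + pi / 2) xi.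
Proof. by apply/funext => z; rewrite /partial; case: (is_derive_wave c th xi z i). Qed.

Lemma continuous_wave c th xi : continuous (wave c th xi).
Proof.
move=> z; have FF : Filter (nbhs z) := nbhs_filter z.
have c_z : (fun=> c) @ nbhs z --> c by exact: cvg_cst.
apply: (cvgM c_z); apply: (continuous_cvg _ (@continuous_cos R _)).
apply: cvgD; first exact: cvg_cst.
apply: (cvg_big (op := +%R)) => [|j _]; first exact: add_continuous.
by apply: cvgM; [exact: cvg_cst|exact: coord_continuous].
Qed.

Lemma smooth_wave c th xi : smooth (wave c th xi).
Proof.
move=> s /=.
have [c' [th' ->]] : exists c' th', foldr partial (wave c th xi) s = wave c' th' xi.
  elim: s => [|i s [c' [th' IH]]]; first by exists c, th.
  by exists (c' * xi i), (th' + pi / 2); rewrite /= IH partial_wave.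
split; first exact: continuous_wave.
by move=> i z; case: (is_derive_wave c' th' xi z i).
Qed.

Lemma laplacian_wave c th xi z :
  laplacian (wave c th xi) z = - (\sum_i xi i ^+ 2) * wave c th xi z.
Proof.
rewrite /laplacian mulNr mulr_suml -sumrN; apply: eq_bigr => i _.
rewrite !partial_wave /wave.
have -> : th + pi / 2 + pi / 2 + \sum_j xi j * z 0 j =
  th + (\sum_j xi j * z 0 j) + pi by field.
by rewrite cosDpi; ring.
Qed.

End plane_wave.

Section weak_laplacian_hartley.
Context {R : realType} {d : nat} (a b : 'I_d -> R).
Hypothesis ab : forall i, a i < b i.
Local Notation mu := (box_measure a b).
Local Notation L2 := (Lfun mu 2%:E).
Implicit Types k : {ffun 'I_d -> int}.

Lemma hartleyE k x : hartley a b k x =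
  wave (Num.sqrt (2 / volume a b)) (- (pi / 4)) (wavenumber a b k) (row_of x).
Proof.
rewrite /hartley /wave /phase; congr (_ * cos (_ + _)).
by apply: eq_bigr => i _; rewrite mxE.
Qed.

Lemma box_periodic_wave c th k : box_periodic a b (wave c th (wavenumber a b k)).
Proof.
move=> z i; rewrite /wave; congr (c * _).
have -> : \sum_j wavenumber a b k j * (z + (b i - a i) *: delta_mx 0 i) 0 j =
    \sum_j wavenumber a b k j * z 0 j + 2 * pi * (k i)%:~R.
  rewrite -(wavenumberE ab) (bigD1 i)//= [in RHS](bigD1 i)//= !mxE !eqxx/= mulr1.
  rewrite mulrDr addrAC; congr (_ + _ + _).
  by apply: eq_bigr => j ji; rewrite !mxE (negbTE ji) andbF mulr0 addr0.
by rewrite addrA cos_periodz.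
Qed.

(** The Hartley functions are test functions and eigenfunctions of the
Laplacian. *)
Lemma weak_laplacian_coef (m lap : Rpoint R d -> R[i]) k :
  weak_laplacian a b m lap -> Lfun2C a b m ->
  dot mu (fun x => complex.Re (lap x)) (hartley a b k) =
    - wavenumber2 a b k * dot mu (fun x => complex.Re (m x)) (hartley a b k) /\
  dot mu (fun x => complex.Im (lap x)) (hartley a b k) =
    - wavenumber2 a b k * dot mu (fun x => complex.Im (m x)) (hartley a b k).
Proof.
move=> wl [m1 m2].
have ReM (z : R[i]) (r : R) : complex.Re (z * r%:C%C) = complex.Re z * r.
  by case: z => ? ? /=; rewrite mulr0 subr0.
have ImM (z : R[i]) (r : R) : complex.Im (z * r%:C%C) = complex.Im z * r.
  by case: z => ? ? /=; rewrite mulr0 add0r.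
have h2 := L2_hartley ab k.
pose c := Num.sqrt (2 / volume a b).
have := wl (wave c (- (pi / 4)) (wavenumber a b k))
  (smooth_wave _ _ _) (box_periodic_wave _ _ _).
move=> [EqRe EqIm]; split.
- rewrite dotC -dotZl// [RHS]dotC.
  transitivity (\int[mu]_x complex.Re
     (lap x * (wave c (- (pi / 4)) (wavenumber a b k) (row_of x))%:C%C)).
    by apply: eq_Rintegral => x _; rewrite ReM hartleyE mulrC.
  rewrite EqRe; apply: eq_Rintegral => x _.
  by rewrite ReM laplacian_wave -hartleyE /wavenumber2; ring.
- rewrite dotC -dotZl// [RHS]dotC.
  transitivity (\int[mu]_x complex.Im
     (lap x * (wave c (- (pi / 4)) (wavenumber a b k) (row_of x))%:C%C)).
    by apply: eq_Rintegral => x _; rewrite ImM hartleyE mulrC.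
  rewrite EqIm; apply: eq_Rintegral => x _.
  by rewrite ImM laplacian_wave -hartleyE /wavenumber2; ring.
Qed.

(** The difference of the two sides is the imaginary part of the integral of
lap conj(m). *)
Lemma weak_laplacian_symmetric (m lap : Rpoint R d -> R[i]) :
  weak_laplacian a b m lap -> Lfun2C a b m -> Lfun2C a b lap ->
  dot mu (fun x => complex.Im (lap x)) (fun x => complex.Re (m x)) =
  dot mu (fun x => complex.Re (lap x)) (fun x => complex.Im (m x)).
Proof.
move=> wl m2 lap2.
apply: (dot_adjoint (L2_hartley ab) (hartley_orthonormal ab) _
    (lam := fun k => - wavenumber2 a b k)).
- by move=> f; exact: hartley_dense.
- by case: m2.
- by case: m2.
- by case: lap2.
- by case: lap2.
- by move=> k; case: (weak_laplacian_coef k wl m2).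
- by move=> k; case: (weak_laplacian_coef k wl m2).
Qed.

End weak_laplacian_hartley.

(** * Conservation of the charge *)

Section charge.
Context {R : realType} {d : nat} (a b : 'I_d -> R).
Hypothesis ab : forall i, a i < b i.
Local Notation mu := (box_measure a b).
Local Notation Re := complex.Re.
Local Notation Im := complex.Im.

Lemma abs2E (z : R[i]) : abs2 z = Re z ^+ 2 + Im z ^+ 2.
Proof.
by case: z => x y; rewrite /abs2 /= sqr_sqrtr// addr_ge0// sqr_ge0.
Qed.

(** The imaginary part of the scheme multiplied by conj(m), up to a factor 2:
the multipliers q and w being real, their terms q |m|^2 and w |m|^2 drop out. *)
Lemma midpoint_charge_density (dt q w : R) (u v l m : R[i]) :
  m = 2^-1 * (v + u) ->
  'i%C * v = 'i%C * u + dt%:C%C * (l + q%:C%C * m) + m * w%:C%C ->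
  abs2 v = abs2 u + 2 * dt * (Im l * Re m - Re l * Im m).
Proof.
move=> mE; have : m * 2%:C%C = v + u.
  by rewrite mE mulrC mulrA rmorph_nat divff ?mul1r// pnatr_eq0.
case: u v l m {mE} => [u1 u2] [v1 v2] [l1 l2] [m1 m2].
rewrite !abs2E /= => -[e1 e2] [e3 e4].
have s1 : v1 + u1 = 2 * m1 by lra.
have s2 : v2 + u2 = 2 * m2 by lra.
have d1 : v1 - u1 = dt * (l2 + q * m2) + m2 * w by lra.
have d2 : v2 - u2 = - (dt * (l1 + q * m1) + m1 * w) by lra.
have -> : v1 ^+ 2 + v2 ^+ 2 = u1 ^+ 2 + u2 ^+ 2 +
    (v1 - u1) * (v1 + u1) + (v2 - u2) * (v2 + u2) by ring.
rewrite s1 s2 d1 d2; ring.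
Qed.

Lemma midpoint_step_charge dt (Q dW : Rpoint R d -> R) (u v : Rpoint R d -> R[i]) :
  Lfun2C a b u -> Lfun2C a b v -> midpoint_step a b dt Q dW u v ->
  total_charge a b v = total_charge a b u.
Proof.
move=> [u1 u2] [v1 v2] [[m2 _] [lap [lap2 wl eqn]]].
set m := midpoint u v in m2 wl eqn.
have abs2_int (z : Rpoint R d -> R[i]) : Lfun2C a b z ->
    mu.-integrable setT (EFin \o (fun x => abs2 (z x))).
  move=> [z1 z2]; apply: eq_integrable (integrableD measurableT
    (Lfun2_integrable_sqr z1) (Lfun2_integrable_sqr z2)) => //.
  by move=> x _ /=; rewrite abs2E.
pose g x := Im (lap x) * Re (m x) - Re (lap x) * Im (m x).
have i1 := integrable_mul lap2.2 m2.1; have i2 := integrable_mul lap2.1 m2.2.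
have ig : mu.-integrable setT (EFin \o g) := integrableB measurableT i1 i2.
have g0 : (\int[mu]_x (g x)%:E = 0)%E.
  rewrite /g integralB_EFin//.
  have := congr1 EFin (weak_laplacian_symmetric ab wl m2 lap2).
  rewrite /dot /Rintegral !fineK; [|exact: (integrable_fin_num measurableT i2)|
    exact: (integrable_fin_num measurableT i1)].
  by move=> ->; rewrite subee//; exact: (integrable_fin_num measurableT i2).
rewrite /total_charge.
transitivity (\int[mu]_x ((abs2 (u x))%:E + (2 * dt)%:E * (g x)%:E))%E.
  apply: ae_eq_integral => //.
  - exact: (measurable_int mu (abs2_int _ (conj v1 v2))).
  - apply: emeasurable_funD.
      exact: (measurable_int mu (abs2_int _ (conj u1 u2))).
    by apply: measurable_funeM; exact: (measurable_int mu ig).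
  - apply: filterS eqn => x ex _; rewrite -EFinM -EFinD; congr EFin.
    exact: midpoint_charge_density ex.
rewrite integralD//; [|exact: abs2_int|exact: integrableZl].
by rewrite integralZl// g0 mule0 adde0.
Qed.

End charge.

Theorem proposition2p1 (R : realType) (d : nat) (hd : (0 < d)%N)
    (a b : 'I_d -> R) (hab : forall i, a i < b i)
    (disp : measure_display) (Omega : measurableType disp)
    (P : probability Omega R)
    (F : R -> set (set Omega)) (hF : filtration F)
    (Q : Rpoint R d -> R) (hQ : sobolev a b 3 (toC Q))
    (gamma : R) (hgamma : 0 <= gamma)
    (e : nat -> Rpoint R d -> R)
    (phi : (Rpoint R d -> R) -> (Rpoint R d -> R))
    (beta : nat -> R -> {RV P >-> measurableTypeR R})
    (W : R -> Omega -> Rpoint R d -> R)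
    (hW : wiener_process a b F gamma e phi beta W)
    (T : R) (hT : 0 < T) (N : nat) (hN : (0 < N)%N)
    (dW : nat -> Omega -> Rpoint R d -> R)
    (hdW : forall n, (n <= N)%N ->
       truncated_increment a b (T / N%:R) e phi beta n (dW n))
    (u0 : Omega -> Rpoint R d -> R[i])
    (u : nat -> Omega -> Rpoint R d -> R[i])
    (hu : midpoint_solution a b P (T / N%:R) N Q dW u0 u) :
  {ae P, forall w, forall n, (n <= N)%N ->
    total_charge a b (u n.+1 w) = total_charge a b (u n w)}.
Proof.
apply: filterS hu => w [_ u2 step] n nN.
by apply: (midpoint_step_charge hab _ _ (step n nN)); apply: u2; rewrite // leqW.
Qed.
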